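(* Let ${\cal B}$ be a properly ordered Bratteli diagram which is focused and has bounded width, and let $(X_{\cal B},V_{\cal B})$ be its Bratteli-Vershik (adic) system. Then there exists a one-dimensional cellular automaton which embeds $(X_{\cal B},V_{\cal B})$; that is, there exist a finite alphabet ${\cal C}$, a cellular automaton $\Phi:{\cal C}^{\mathbb Z}\to{\cal C}^{\mathbb Z}$, a closed subset $X\subset {\cal C}^{\mathbb Z}$ with $\Phi(X)\subseteq X$, and a homeomorphism $f:X_{\cal B}\to X$ such that $f\circ V_{\cal B}=\Phi\circ f$.
   Context: **Cellular automata.** For a finite alphabet ${\cal C}$, ${\cal C}^{\mathbb Z}$ has the product topology (with ${\cal C}$ discrete), and the shift is $(\sigma(x))_n=x_{n+1}$. A (one-dimensional) cellular automaton is a continuous map $\Phi:{\cal C}^{\mathbb Z}\to{\cal C}^{\mathbb Z}$ commuting with $\sigma$. **Bratteli diagrams.** A Bratteli diagram ${\cal B}=({\cal V},{\cal E})$ is an infinite directed graph with vertex set ${\cal V}=\bigsqcup_{n\ge 0}{\cal V}_n$ and edge set ${\cal E}=\bigsqcup_{n\ge 1}{\cal E}_n$ (multiple edges allowed), where all ${\cal V}_n,{\cal E}_n$ are finite, ${\cal V}_0$ is a single vertex, and each edge $x\in{\cal E}_n$ has source $s(x)\in{\cal V}_n$ and range $r(x)\in{\cal V}_{n-1}$. Every vertex in ${\cal V}_n$, $n\ge1$, is the source of at least one edge. An infinite path is a sequence $(x_n)_{n\ge 1}$ with $x_n\in{\cal E}_n$ and $s(x_n)=r(x_{n+1})$ for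 all $n\ge 1$. The set of infinite paths is $X_{\cal B}\subset\prod_{n\ge1}{\cal E}_n$, with the topology induced from the product topology (each ${\cal E}_n$ discrete). Given integers $0=n_0<n_1<n_2<\cdots$, the corresponding telescoping of ${\cal B}$ is the diagram ${\cal B}'$ with ${\cal V}'_k={\cal V}_{n_k}$ and with as many edges from $v'\in{\cal V}'_{k+1}$ to $w'\in{\cal V}'_k$ as there are paths in ${\cal B}$ from the corresponding vertex of ${\cal V}_{n_{k+1}}$ to the corresponding vertex of ${\cal V}_{n_k}$. ${\cal B}$ is simple if it has a telescoping ${\cal B}'$ such that for all $n$, all $a\in{\cal V}'_{n+1}$ and $b\in{\cal V}'_n$, there is at least one edge from $a$ to $b$. **Order.** ${\cal B}$ is ordered if for each $n\ge1$ and $a\in{\cal V}_n$ the set ${\cal E}_n(a)=\{x\in{\cal E}_n: s(x)=a\}$ is given a linear order. An edge is minimal (maximal) if it is the least (greatest) element of ${\cal E}_n(s(x))$; an infinite path is minimal (maximal) if all its edges are minimal (maximal). A simple ordered Bratteli diagram is properly ordered if it has exactly one minimal infinite path ${\bf x}_{\min}$ and exactly one maximal infinite path ${\bf x}_{\max}$. **Adic system.** If $(x_n)_{n\ge1}\in X_{\cal B}$ is not maximal, let $k$ be the smallest integer such that $x_k$ is not maximal, and let $y_k$ be the successor of $x_k$ in ${\cal E}_k(s(x_k))$. Then $V_{\cal B}((x_n))$ is the path which has edge $x_n$ for $n>k$, edge $y_k$ at level $k$, and minimal edges at levels $k-1,\dots,1$ (following the path down from $r(y_k)$). For ${\cal B}$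 properly ordered, set $V_{\cal B}({\bf x}_{\max})={\bf x}_{\min}$; then $V_{\cal B}:X_{\cal B}\to X_{\cal B}$ is a homeomorphism. **Bounded width and focus.** ${\cal B}$ has bounded width if there is a constant $K$ such that $|{\cal V}_n|\le K$ and $|{\cal E}_n|\le K$ for all $n\ge1$. An ordered ${\cal B}$ is focused if, for each $n\ge1$, all minimal edges in ${\cal E}_n$ have the same range. *)

(* Defs.v *)
From HB Require Import structures.
From mathcomp Require Import all_boot all_order all_algebra.
From mathcomp Require Import all_classical topology.

Set Implicit Arguments.
Unset Strict Implicit.
Unset Printing Implicit Defensive.

Import GRing.Theory.
Local Open Scope classical_set_scope.

Definition config (C : finType) := {ptws int -> discrete_topology C}.

Definition shift (C : finType) (x : config C) : config C :=
  fun n => x (n + 1)%R.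

Definition cellular_automaton (C : finType) (Phi : config C -> config C) :=
  continuous Phi /\ forall x, Phi (shift x) = shift (Phi x).

Definition homeomorphism (S T : topologicalType) (f : S -> T) :=
  continuous f /\
  exists g : T -> S, [/\ cancel f g, cancel g f & continuous g].

Definition embeds (C : finType) (Phi : config C -> config C)
    (T : topologicalType) (V : T -> T) :=
  exists (X : set (config C)) (f : T -> X),
    [/\ closed X, Phi @` X `<=` X, homeomorphism f
      & forall x, val (f (V x)) = Phi (val (f x))].

(* Vertex levels are numbered from 0 and edge levels from 1 in the usual
   notation; here [edg n] is the level usually written E_{n+1}, whose edges go
   from V_{n+1} to V_n. *)
Record bratteli := Bratteli {
  vtx : nat -> finType;
  edg : nat -> finType;
  src : forall n, edg n -> vtx n.+1;
  rng : forall n, edg n -> vtx n;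
  vtx0_single : #|vtx 0| = 1;
  src_surj : forall n (a : vtx n.+1), exists x : edg n, src x = a
}.

Definition path_space (B : bratteli) :
    set (prod_topology (fun n => discrete_topology (edg B n))) :=
  [set x | forall n, @src B n (x n) = @rng B n.+1 (x n.+1)].

Arguments path_space : clear implicits.

(* [set_type] carries the topology induced by the inclusion. *)
Definition ipath (B : bratteli) : topologicalType := set_type (path_space B).

Definition ipath_edge (B : bratteli) (x : ipath B) (n : nat) : edg B n :=
  set_val x n.

(* The finite paths of length [d] from level [d + m] down to level [m],
   together with their source and range. *)
Fixpoint fpath (B : bratteli) (m d : nat) :
    {T : finType & ((T -> vtx B (d + m)) * (T -> vtx B m))%type} :=
  match d with
  | 0 => existT _ (vtx B m) (id, id)
  | d'.+1 =>
    let: existT T (s, r) := fpath B m d' in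
    existT (fun U : finType =>
              ((U -> vtx B (d'.+1 + m)) * (U -> vtx B m))%type)
      {p : edg B (d' + m) * T | rng p.1 == s p.2}
      (fun p => src (val p).1, fun p => r (val p).2)
  end.

Definition fpath_src (B : bratteli) (m d : nat) :
  projT1 (fpath B m d) -> vtx B (d + m) := (projT2 (fpath B m d)).1.

Definition fpath_rng (B : bratteli) (m d : nat) :
  projT1 (fpath B m d) -> vtx B m := (projT2 (fpath B m d)).2.

Lemma fpath_src_surj (B : bratteli) (m d : nat) (a : vtx B (d + m)) :
  exists p, @fpath_src B m d p = a.
Proof.
elim: d a => [|d IHd] a; first by exists a.
have [e ea] := src_surj a; have [p pe] := IHd (rng e).
rewrite /fpath_src /=; move: p pe; rewrite /fpath_src.
case: (fpath B m d) => T [s r] /= p pe.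
have ep : rng (e, p).1 == s (e, p).2 by rewrite /= pe.
by exists (exist _ (e, p) ep).
Qed.

Section Telescoping.
Variables (B : bratteli) (n : nat -> nat).
Hypotheses (n0 : n 0 = 0) (n_incr : forall k, n k < n k.+1).

Let len k := n k.+1 - n k.

Let lenK k : len k + n k = n k.+1.
Proof. exact/subnK/ltnW/n_incr. Qed.

Let tsrc k (p : projT1 (fpath B (n k) (len k))) : vtx B (n k.+1) :=
  ecast i (vtx B i) (lenK k) (fpath_src p).

Let tvtx0_single : #|vtx B (n 0)| = 1.
Proof. by rewrite n0 vtx0_single. Qed.

Let tsrc_surj k (a : vtx B (n k.+1)) : exists p, @tsrc k p = a.
Proof.
rewrite /tsrc; case: _ / (lenK k) a => a /=; exact: fpath_src_surj.
Qed.

Definition telescoping : bratteli :=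
  @Bratteli (fun k => vtx B (n k)) (fun k => projT1 (fpath B (n k) (len k)))
    tsrc (fun k => @fpath_rng B (n k) (len k)) tvtx0_single tsrc_surj.

End Telescoping.

Definition simple (B : bratteli) :=
  exists (n : nat -> nat) (n0 : n 0 = 0) (n_incr : forall k, n k < n k.+1),
    forall k (a : vtx (telescoping B n0 n_incr) k.+1)
      (b : vtx (telescoping B n0 n_incr) k),
    exists e : edg (telescoping B n0 n_incr) k, src e = a /\ rng e = b.

Definition bounded_width (B : bratteli) :=
  exists K : nat, forall n, #|vtx B n.+1| <= K /\ #|edg B n| <= K.

Definition linear_order_on (T : Type) (A : pred T) (r : rel T) :=
  [/\ {in A, reflexive r}, {in A &, antisymmetric r},
      {in A & &, transitive r} & {in A &, total r}].

(* The value of [ele x y] carries no meaning unless [x] and [y] have the same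
   source. *)
Record ordered_bratteli := OrderedBratteli {
  diagram :> bratteli;
  ele : forall n, rel (edg diagram n);
  ele_linear : forall n (a : vtx diagram n.+1),
    linear_order_on [pred x | src x == a] (@ele n)
}.

Section Adic.
Variable B : ordered_bratteli.

Definition min_edge n (x : edg B n) :=
  [forall y, (src y == src x) ==> ele x y].

Definition max_edge n (x : edg B n) :=
  [forall y, (src y == src x) ==> ele y x].

Definition succ_edge n (x y : edg B n) :=
  [/\ src y = src x, ele x y, x != y
    & forall z, src z = src x -> ele x z -> x != z -> ele y z].

Definition min_path (x : ipath B) := forall n, min_edge (ipath_edge x n).
Definition max_path (x : ipath B) := forall n, max_edge (ipath_edge x n).

Definition properly_ordered :=
  [/\ simple B, exists! x, min_path x & exists! x, max_path x].

Definition focused :=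
  forall n (x y : edg B n), min_edge x -> min_edge y -> rng x = rng y.

Definition adic_step (x y : ipath B) :=
  exists k,
    [/\ (forall n, n < k -> max_edge (ipath_edge x n)) /\
          ~~ max_edge (ipath_edge x k),
        forall n, k < n -> ipath_edge y n = ipath_edge x n,
        succ_edge (ipath_edge x k) (ipath_edge y k)
      & forall n, n < k -> min_edge (ipath_edge y n)].

Definition xmin (hB : properly_ordered) : ipath B :=
  let: And3 _ h _ := hB in projT1 (cid h).

(* [adic_step x] is a singleton when [x] is not maximal and empty when it is,
   so the default value [xmin hB] is taken exactly at the maximal path; see
   [vershikP] and [vershik_max]. *)
Definition vershik (hB : properly_ordered) (x : ipath B) : ipath B :=
  xget (xmin hB) [set y | adic_step x y].

Lemma xminP (hB : properly_ordered) : min_path (xmin hB).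
Proof. by case: hB => ? h ?; rewrite /xmin; case: cid => x [] /=. Qed.

Lemma ele_anti n (x y : edg B n) :
  src x = src y -> ele x y -> ele y x -> x = y.
Proof.
move=> sxy xy yx; have [_ anti _ _] := ele_linear (src y).
by apply: anti; rewrite ?inE ?sxy ?xy //=.
Qed.

Lemma min_edge_uniq n (x y : edg B n) :
  src x = src y -> min_edge x -> min_edge y -> x = y.
Proof.
move=> sxy /forallP/(_ y) + /forallP/(_ x).
by rewrite sxy eqxx /=; exact: ele_anti.
Qed.

Lemma succ_edge_uniq n (x y z : edg B n) :
  succ_edge x y -> succ_edge x z -> y = z.
Proof.
move=> [sy xy nxy miny] [sz xz nxz minz].
by apply: ele_anti; [rewrite sy | exact: miny | exact: minz].
Qed.

Lemma least_edge n (P : pred (edg B n)) (a : vtx B n.+1) (x0 : edg B n) :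
  src x0 = a -> P x0 ->
  exists2 x, src x = a /\ P x & forall y, src y = a -> P y -> ele x y.
Proof.
move=> sx0 Px0; have [refl _ trans tot] := ele_linear a.
pose Q := [pred x | (src x == a) && P x].
have Qa x : x \in Q -> x \in [pred x | src x == a] by case/andP.
have Qx0 : Q x0 by rewrite /= sx0 eqxx.
have [x y z] := @extremum_inP _ _ (@ele B n) x0 Q id
  (sub_in1 Qa refl) (sub_in3 Qa trans) (sub_in2 Qa tot) Qx0.
case/andP: y => /eqP sx Px; exists x => // y sy Py.
by apply: z; rewrite /= sy eqxx.
Qed.

Lemma min_edge_ex n (a : vtx B n.+1) : exists2 x, src x = a & min_edge x.
Proof.
have [x0 sx0] := src_surj a.
have [x [sx _] xmin] := least_edge (P := xpredT) sx0 isT.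
by exists x => //; apply/forallP => y; apply/implyP => /eqP; rewrite sx => ?;
  exact: xmin.
Qed.

Lemma succ_edge_ex n (x : edg B n) : ~~ max_edge x -> exists y, succ_edge x y.
Proof.
case/forallPn => y; rewrite negb_imply => /andP[/eqP sy nyx].
have [refl _ _ tot] := ele_linear (src x).
have xy : ele x y.
  by have := tot x y; rewrite !inE sy eqxx (negPf nyx) orbF; apply.
have nxy : x != y.
  by apply: contraNneq nyx => <-; apply: refl; rewrite inE.
have [z [sz /andP[xz nxz]] zmin] :=
  least_edge (P := [pred z | ele x z & x != z]) sy (introT andP (conj xy nxy)).
by exists z; split => // w sw xw nxw; apply: zmin => //; apply/andP.
Qed.

Lemma min_descend k (x : forall n, edg B n) :
  exists y : forall n, edg B n,
    [/\ forall n, k <= n -> y n = x n, forall n, n < k -> min_edge (y n)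
      & forall n, n < k -> src (y n) = rng (y n.+1)].
Proof.
elim: k x => [|k IHk] x; first by exists x.
have [e se emin] := min_edge_ex (rng (x k.+1)).
have [y [yx ymin ysrc]] := IHk (eqtype.dfwith x e); exists y; split=> n.
- by move=> kn; rewrite yx ?(ltnW kn) // eqtype.dfwith_out // ltn_eqF.
- rewrite ltnS leq_eqVlt => /predU1P[->|]; last exact: ymin.
  by rewrite yx // eqtype.dfwith_in.
- rewrite ltnS leq_eqVlt => /predU1P[->|]; last exact: ysrc.
  by rewrite !yx // eqtype.dfwith_in eqtype.dfwith_out ?se // ltn_eqF.
Qed.

Lemma adic_step_ex x : ~ max_path x -> exists y, adic_step x y.
Proof.
move=> /existsNP nmax.
have {}nmax : exists n, ~~ max_edge (ipath_edge x n).
  by case: nmax => n /negP; exists n.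
have [k nk kmin] := ex_minnP nmax.
have [e es] := succ_edge_ex nk.
have [y [yx ymin ysrc]] := min_descend k (eqtype.dfwith (ipath_edge x) e).
have ygt n : k < n -> y n = ipath_edge x n.
  by move=> kn; rewrite yx ?(ltnW kn) // eqtype.dfwith_out // ltn_eqF.
have yk : y k = e by rewrite yx // eqtype.dfwith_in.
have xpath n : src (ipath_edge x n) = rng (ipath_edge x n.+1).
  exact: (set_valP x).
have ypath : path_space B y.
  move=> n; have [|kn|->] := ltngtP n k; first exact: ysrc.
    by rewrite !ygt // ltnW.
  by rewrite yk ygt //; case: es => ->.
exists (exist _ y (mem_set ypath)), k; rewrite /ipath_edge set_valE /=.
split=> //; last by rewrite yk.
split=> // n nlt; apply/negPn/negP => /kmin; by rewrite leqNgt nlt.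
Qed.

Lemma adic_step_uniq x y z : adic_step x y -> adic_step x z -> y = z.
Proof.
move=> [k [[xmax nxk] yx ysucc ymin]] [l [[xmax' nxl] zx zsucc zmin]].
have kl : k = l.
  case: (ltngtP k l) => // [/xmax'|/xmax] h; first by rewrite h in nxk.
  by rewrite h in nxl.
subst l; apply: val_inj; apply: functional_extensionality_dep => n.
have ypath m : src (ipath_edge y m) = rng (ipath_edge y m.+1).
  exact: (set_valP y).
have zpath m : src (ipath_edge z m) = rng (ipath_edge z m.+1).
  exact: (set_valP z).
suff: ipath_edge y n = ipath_edge z n by [].
have [nk|nk|->] := ltngtP n k; [|by rewrite yx ?zx|exact: succ_edge_uniq zsucc].
rewrite -(subKn (ltnW nk)); elim: (k - n) => [|d IHd].
  by rewrite subn0; exact: succ_edge_uniq ysucc zsucc.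
have [kd|dk] := leqP k d.
  by move: IHd; rewrite (eqP (kd : k - d == 0)) (eqP (leqW kd : k - d.+1 == 0)).
have e : (k - d.+1).+1 = k - d by rewrite subnSK.
have lt : k - d.+1 < k by rewrite ltn_subrL /= (leq_ltn_trans _ dk).
apply: min_edge_uniq; [|exact: ymin|exact: zmin].
by rewrite ypath zpath e IHd.
Qed.

Lemma vershikP (hB : properly_ordered) x :
  ~ max_path x -> adic_step x (vershik hB x).
Proof. by move=> /adic_step_ex; exact: xgetPex. Qed.

Lemma vershik_max (hB : properly_ordered) x :
  max_path x -> vershik hB x = xmin hB.
Proof.
by move=> xmax; apply: xgetPN => y [k [[_ +] _ _ _]]; rewrite xmax.
Qed.

End Adic.

(* Main.v *)
(* Spread the path over space, letting cell [n] lag [n] time steps behind: it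
   displays edge [m + n] of [V^-n x], together with a bit telling whether the
   edges up to that one are all minimal. The carry of the adic map then moves
   right at speed one: the bit of the left neighbour, which has already made the
   step, says whether the carry reaches the cell. If it does and the edge is
   maximal, the edge becomes minimal, with a source that depends on the new edge
   one level up. By focus, the old edge one level up determines that source, and
   the right neighbour, one step late, shows it: its edge did not change in that
   step, since [V^-n x] is maximal and hence not minimal on the first levels.
   The latter holds for [m] large, by compactness and because the minimal and
   maximal paths differ; if they coincide, simplicity leaves a single path. The
   dependence on the level is absorbed in an update table that each cell carries
   along, drawn from a finite set by bounded width. *)

Require Import Defs.
From mathcomp Require Import all_boot all_algebra.
From mathcomp Require Import all_classical topology.

Set Implicit Arguments.
Unset Strict Implicit.
Unset Printing Implicit Defensive.

Import GRing.Theory.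
Local Open Scope classical_set_scope.

(** * Continuity and compactness in products and subspaces *)

Section Topology.

Lemma discrete_continuousP (S : topologicalType) (T : choiceType)
    (f : S -> discrete_topology T) :
  continuous f <-> forall x, \forall y \near x, f y = f x.
Proof.
split=> h x.
  have /(@discrete_cvg (discrete_topology T)) := h x; exact.
by apply/(@discrete_cvg (discrete_topology T)); exact: h.
Qed.

Lemma prod_continuous (I : eqType) (S : topologicalType)
    (T : I -> topologicalType) (f : S -> prod_topology T) :
  (forall i, continuous (fun x => f x i)) -> continuous f.
Proof.
move=> fc x; apply/cvg_sup => i U /= [_ [[B oB <-] Bx BU]].
by apply: (filterS BU); apply: (fc i x B); exact: open_nbhs_nbhs.
Qed.

Lemma prod_coord_near (I : eqType) (T : I -> choiceType)
    (x : prod_topology (fun i => discrete_topology (T i))) (i : I) :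
  \forall y \near x, y i = x i.
Proof.
have h := @proj_continuous I (fun i => discrete_topology (T i)) i.
pose P : topologicalType := prod_topology (fun i => discrete_topology (T i)).
exact: ((@discrete_continuousP P (T i) (fun y => y i)).1 h x).
Qed.

Lemma set_type_hausdorff (T : topologicalType) (A : set T) :
  hausdorff_space T -> hausdorff_space (set_type A).
Proof.
move=> hT p q pq; apply: val_inj; apply: hT => U V Up Vq.
have [r [Ur Vr]] := pq _ _ (initial_continuous Up) (initial_continuous Vq).
by exists (val r).
Qed.

Lemma set_type_compact (T : topologicalType) (A : set T) :
  compact A -> compact [set: set_type A].
Proof.
move=> cA F FF _.
have [|p [Ap pF]] := cA (set_val @ F) _.
  by apply: (@filterS _ F _ setT) => [x _|]; [exact: (set_valP x)|
    exact: filterT].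
exists (exist _ p (mem_set Ap)); split=> // U W FU [_ [[B oB <-] Bp BW]].
have [| |_ [[r Ur <-] Br]] := pF (set_val @` U) B.
- by apply: (@filterS _ F _ U) => // r Ur; exists r.
- by apply: open_nbhs_nbhs.
- by exists r; split=> //; exact: BW.
Qed.

Lemma compact_homeomorphism (S T : topologicalType) (f : S -> T) (g : T -> S) :
  compact [set: S] -> hausdorff_space T -> continuous f ->
  cancel f g -> cancel g f -> homeomorphism f.
Proof.
move=> cS hT cf fK gK; split=> //; exists g; split=> //.
apply/continuousP => A oA; rewrite -[_ @^-1` _]setCK; apply: closed_openC.
suff -> : ~` (g @^-1` A) = f @` (~` A).
  apply: compact_closed => //; apply: continuous_compact.
    exact: continuous_subspaceT.
  by apply: subclosed_compact cS _ => //; exact: open_closedC.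
apply/seteqP; split=> [y /= nAy|_ [x /= nAx <-]] /=; last by rewrite fK.
by exists (g y).
Qed.

End Topology.

(** * Cellular automata given by a local rule, and a criterion for embedding *)

Definition local_map (C : finType) (rule : C -> C -> C -> C) :
    config C -> config C :=
  fun c n => rule (c (n - 1)%R) (c n) (c (n + 1)%R).

Lemma local_map_ca (C : finType) (rule : C -> C -> C -> C) :
  cellular_automaton (local_map rule).
Proof.
split; last first.
  by move=> c; apply: funext => n; rewrite /local_map /shift addrAC.
apply: prod_continuous => n; apply/discrete_continuousP => c.
pose A i : set (config C) := [set d | d i = c i].
have h i : nbhs c (A i) by exact: (@prod_coord_near int (fun=> C) c i).
apply: (@filterS (config C) (nbhs c) _ (A (n - 1)%R `&` A n `&` A (n + 1)%R)).
  by move=> d [[e1 e2] e3]; exact: (f_equal3 rule e1 e2 e3).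
by apply: filterI; first exact: filterI.
Qed.

Section Criterion.
Variables (T : topologicalType) (V : T -> T) (S : finType) (t : int -> T -> S).
Hypotheses (T_compact : compact [set: T])
  (t_near : forall n x, \forall y \near x, t n y = t n x)
  (t_sep : forall x y,
     (forall n j, t n (iter j V x) = t n (iter j V y)) -> x = y)
  (t_local : forall n x y,
     t (n - 1)%R x = t (n - 1)%R y -> t n x = t n y ->
     t (n + 1)%R x = t (n + 1)%R y -> t n (V x) = t n (V y)).

Let table := {ffun S * S * S -> S}.
Let cell : finType := (table * S)%type.

(** By [t_local] the entry does not depend on the point chosen by [cid]. Triples that no point shows
    around cell [n] get their middle entry, an arbitrary default. *)
Let upd (n : int) : table := [ffun p =>
  if pselect (exists x, (t (n - 1) x, t n x, t (n + 1) x)%R = p) is left e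
  then t n (V (projT1 (cid e))) else p.1.2].

Let updE n x :
  upd n (t (n - 1)%R x, t n x, t (n + 1)%R x) = t n (V x).
Proof.
rewrite ffunE; case: pselect => [e|[]]; last by exists x.
by case: cid => y /= [? ? ?]; exact: t_local.
Qed.

Let rule (l c r : cell) : cell := (c.1, c.1 (l.2, c.2, r.2)).

Let Phi : config cell -> config cell := local_map rule.

Let code (x : T) : config cell := fun n => (upd n, t n x).

Let Phi_code x : Phi (code x) = code (V x).
Proof. by apply: funext => n; rewrite /Phi /local_map /rule /code /= updE. Qed.

(** Through [Phi], the code of [x] determines the codes of all iterates [V^j x], so it is enough
    that [t] separates orbits. *)
Let code_inj : injective code.
Proof.
move=> x y xy; apply: t_sep => n j.
suff : code (iter j V x) = code (iter j V y) by move=> /(congr1 (@^~ n)) [].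
by elim: j => //= j IHj; rewrite -!Phi_code IHj.
Qed.

Let code_continuous : continuous code.
Proof.
apply: prod_continuous => n; apply/discrete_continuousP => x.
by apply: filterS (t_near n x) => y h; rewrite /code h.
Qed.

Lemma local_coding_embeds :
  exists (C : finType) (Phi : config C -> config C),
    cellular_automaton Phi /\ embeds Phi V.
Proof.
exists cell, Phi; split; first exact: local_map_ca.
have im x : code x \in range code by apply/mem_set; exists x.
have hausd : hausdorff_space (config cell).
  by apply: hausdorff_product => n; exact: discrete_hausdorff.
pose f x : set_type (range code) := exist _ (code x) (im x).
have fV (c : set_type (range code)) : {x | code x = set_val c}.
  apply: cid; have [x _ xc] : range code (set_val c) := set_valP c.
  by exists x.
exists (range code), f; split.
- apply: compact_closed => //; apply: continuous_compact => //.
  exact: continuous_subspaceT.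
- by move=> _ [_ [x _ <-] <-]; exists (V x); rewrite -?Phi_code.
- apply: (@compact_homeomorphism _ _ f (fun c => sval (fV c))) => //.
  + exact: set_type_hausdorff.
  + exact: (@continuous_comp_initial _ _ _ set_val).
  + by move=> x; case: fV => y /= /code_inj.
  + by move=> c; apply: val_inj; rewrite /=; case: fV.
- by move=> x; rewrite Phi_code.
Qed.

End Criterion.

(** * The space of infinite paths *)

Section PathSpace.
Variable B : bratteli.
Implicit Types x y : ipath B.

Lemma ipath_src x n : src (ipath_edge x n) = rng (ipath_edge x n.+1).
Proof. exact: (set_valP x). Qed.

Lemma ipath_ext x y : (forall n, ipath_edge x n = ipath_edge y n) -> x = y.
Proof.
move=> xy; apply: val_inj; apply: functional_extensionality_dep => n.
exact: xy.
Qed.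

Lemma ipath_edge_near x n : \forall y \near x, ipath_edge y n = ipath_edge x n.
Proof.
have h := @prod_coord_near nat (fun n => edg B n) (set_val x) n.
exact: (@initial_continuous _ _ set_val x _ h).
Qed.

Lemma ipath_prefix_near x N :
  \forall y \near x, forall n, n < N -> ipath_edge y n = ipath_edge x n.
Proof.
elim: N => [|N IHN]; first by apply: (@nearW _ _ _ (nbhs_filter x)) => y n.
apply: filterS2 IHN (ipath_edge_near x N) => y yx yN n.
by rewrite ltnS leq_eqVlt => /predU1P[->|/yx].
Qed.

Lemma ipath_compact : compact [set: ipath B].
Proof.
pose P : topologicalType :=
  prod_topology (fun n => discrete_topology (edg B n)).
have cpt : compact [set: P].
  have := @tychonoff nat (fun n => discrete_topology (edg B n)) (fun=> setT).
  have -> : [set f | forall n, [set: discrete_topology (edg B n)] (f n)] =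
      [set: P].
    by apply/seteqP; split.
  by apply=> n; apply: finite_compact; exact: finite_finset.
apply: (@set_type_compact P (path_space B)).
(* Each path condition involves two coordinates only, so it passes to limits. *)
apply: (subclosed_compact _ cpt) => // p clp n.
have near_p i := @prod_coord_near nat (fun n => edg B n) p i.
have /clp[x [xB [xn xn1]]] :
    nbhs p ([set x : P | x n = p n] `&` [set x : P | x n.+1 = p n.+1]).
  by apply: filterI; exact: near_p.
by rewrite -xn -xn1; exact: xB.
Qed.

End PathSpace.

(** * The adic map on finite prefixes *)

Section Adic.
Variable B : ordered_bratteli.
Implicit Types x y z : ipath B.

Definition min_upto x N := [forall i : 'I_N, min_edge (ipath_edge x i)].
Definition max_upto x N := [forall i : 'I_N, max_edge (ipath_edge x i)].

Lemma min_uptoP x N :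
  reflect (forall n, n < N -> min_edge (ipath_edge x n)) (min_upto x N).
Proof.
apply: (iffP forallP) => h n; last exact: h.
by move=> nN; exact: (h (Ordinal nN)).
Qed.

Lemma max_uptoP x N :
  reflect (forall n, n < N -> max_edge (ipath_edge x n)) (max_upto x N).
Proof.
apply: (iffP forallP) => h n; last exact: h.
by move=> nN; exact: (h (Ordinal nN)).
Qed.

Lemma min_uptoS x N :
  min_upto x N.+1 = min_upto x N && min_edge (ipath_edge x N).
Proof.
apply/min_uptoP/andP => [h|[/min_uptoP h xN] n].
  by split; [apply/min_uptoP => n nN|]; apply: h => //; exact: leqW.
by rewrite ltnS leq_eqVlt => /predU1P[->|/h].
Qed.

Lemma max_uptoS x N :
  max_upto x N.+1 = max_upto x N && max_edge (ipath_edge x N).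
Proof.
apply/max_uptoP/andP => [h|[/max_uptoP h xN] n].
  by split; [apply/max_uptoP => n nN|]; apply: h => //; exact: leqW.
by rewrite ltnS leq_eqVlt => /predU1P[->|/h].
Qed.

Lemma min_upto_eq x y N :
  (forall n, n < N -> ipath_edge x n = ipath_edge y n) ->
  min_upto x N = min_upto y N.
Proof. by move=> xy; apply: eq_forallb => i; rewrite xy. Qed.

Lemma max_upto_eq x y N :
  (forall n, n < N -> ipath_edge x n = ipath_edge y n) ->
  max_upto x N = max_upto y N.
Proof. by move=> xy; apply: eq_forallb => i; rewrite xy. Qed.

(** Going down from level [N], the source of the next edge is known, and only one minimal edge
    leaves it. *)
Lemma min_upto_inj x y N :
  min_upto x N -> min_upto y N ->
  rng (ipath_edge x N) = rng (ipath_edge y N) ->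
  forall n, n < N -> ipath_edge x n = ipath_edge y n.
Proof.
elim: N => // N IHN; rewrite !min_uptoS => /andP[mx mxN] /andP[my myN] e.
have eN : ipath_edge x N = ipath_edge y N.
  by apply: min_edge_uniq => //; rewrite !ipath_src.
move=> n; rewrite ltnS leq_eqVlt => /predU1P[->//|].
by apply: IHN; rewrite ?eN.
Qed.

Lemma succ_edge_nmin n (e f : edg B n) : succ_edge e f -> ~~ min_edge f.
Proof.
move=> [sf ef nef _]; apply/negP => /forallP/(_ e); rewrite sf eqxx /= => fe.
by rewrite (ele_anti _ ef fe) ?eqxx // in nef.
Qed.

Lemma succ_edge_nmax n (e f : edg B n) : succ_edge e f -> ~~ max_edge e.
Proof.
move=> [sf ef nef _]; apply/negP => /forallP/(_ f); rewrite sf eqxx /= => fe.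
by rewrite (ele_anti _ ef fe) ?eqxx // in nef.
Qed.

Lemma min_path_upto x N : min_path x -> min_upto x N.
Proof. by move=> h; apply/min_uptoP. Qed.

Lemma max_path_upto x N : max_path x -> max_upto x N.
Proof. by move=> h; apply/max_uptoP. Qed.

Section Vershik.
Variable hB : properly_ordered B.
Let V := vershik hB.

Lemma vershik_cases x :
  adic_step x (V x) \/ max_path x /\ min_path (V x).
Proof.
have [xmax|] := pselect (max_path x); last by move/(vershikP hB); left.
by right; split=> //; rewrite /V vershik_max //; exact: xminP.
Qed.

Lemma vershik_unique x y :
  adic_step x y \/ max_path x /\ min_path y -> V x = y.
Proof.
case=> [xy|[xmax ymin]].
  have xnmax : ~ max_path x by case: xy => k [[_ /negP nk] _ _ _] /(_ k).
  exact: adic_step_uniq (vershikP hB xnmax) xy.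
rewrite /V vershik_max //; have [_ [p [_ pu]] _] := hB.
by rewrite -(pu _ ymin) -(pu _ (xminP hB)).
Qed.

Lemma vershik_above x N : ~~ max_upto x N ->
  forall n, N <= n -> ipath_edge (V x) n = ipath_edge x n.
Proof.
move=> nmax n Nn.
case: (vershik_cases x) => [|[/(max_path_upto N)]]; last first.
  by rewrite (negPf nmax).
move=> [k [[kmax _] above _ _]]; apply: above; rewrite (leq_trans _ Nn) //.
by rewrite ltnNge; apply: contra nmax => Nk; apply/max_uptoP => i iN;
  apply: kmax; exact: leq_trans Nk.
Qed.

Lemma vershik_succ x N : max_upto x N -> ~~ max_edge (ipath_edge x N) ->
  succ_edge (ipath_edge x N) (ipath_edge (V x) N).
Proof.
move=> /max_uptoP xN nxN; case: (vershik_cases x) => [|[/(_ N)]]; last first.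
  by rewrite (negPf nxN).
move=> [k [[kmax nk] _ ksucc _]]; suff -> : N = k by [].
by case: (ltngtP N k) nxN nk => // [/kmax ->|/xN ->].
Qed.

(** This reads the carry off the image: a carry through [N] levels leaves minimal edges behind,
    while one that stops earlier leaves a successor, which is never minimal. *)
Lemma vershik_upto x N : min_upto (V x) N = max_upto x N.
Proof.
apply/idP/idP => [minV|maxN].
  apply/negPn/negP => nmax.
  have : exists n, ~~ max_edge (ipath_edge x n).
    by move: nmax; rewrite negb_forall => /existsP[i ni]; exists i.
  move=> /ex_minnP[k nk kmin].
  have kmax : max_upto x k.
    by apply/max_uptoP => n nk'; apply/negPn/negP => /kmin; rewrite leqNgt nk'.
  have kN : k < N.
    rewrite ltnNge; apply: contra nmax => Nk; apply/max_uptoP => n nN.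
    by move/max_uptoP: kmax; apply; exact: leq_trans Nk.
  have /succ_edge_nmin/negP := vershik_succ kmax nk; apply.
  by move/min_uptoP: minV; exact.
case: (vershik_cases x) => [|[_]]; last exact: min_path_upto.
move=> [k [[_ nk] _ _ kmin]]; apply/min_uptoP => n nN; apply: kmin.
apply: (leq_trans nN); rewrite leqNgt; apply: contra nk => kN.
by move/max_uptoP: maxN; exact.
Qed.

(** A carry that stops below [N] ignores all higher edges: where it stops both paths take the same
    successor, whose range fixes the minimal edges below. *)
Lemma vershik_prefix x y N :
  (forall n, n < N -> ipath_edge x n = ipath_edge y n) -> ~~ max_upto x N ->
  forall n, n < N -> ipath_edge (V x) n = ipath_edge (V y) n.
Proof.
elim: N => // N IHN xy; rewrite max_uptoS.
have {}IHN := IHN (fun n nN => xy n (leqW nN)).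
have eN : ipath_edge x N = ipath_edge y N by exact: xy.
have xyN : max_upto x N = max_upto y N.
  by apply: max_upto_eq => n nN; apply: xy; exact: leqW.
case: (boolP (max_upto x N)) => /= [xN nxN|nxN _] n; last first.
  rewrite ltnS leq_eqVlt => /predU1P[->|]; last exact: IHN.
  by rewrite !(@vershik_above _ N) -?xyN.
have yN : max_upto y N by rewrite -xyN.
have eVN : ipath_edge (V x) N = ipath_edge (V y) N.
  apply: (@succ_edge_uniq _ _ (ipath_edge x N)); first exact: vershik_succ.
  by rewrite eN; apply: vershik_succ => //; rewrite -eN.
rewrite ltnS leq_eqVlt => /predU1P[->//|].
by apply: min_upto_inj; rewrite ?vershik_upto ?eVN.
Qed.

(** Otherwise counterexamples [z M] for every [M] have a cluster point, which is a minimal path with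
    a wrong edge [N], against uniqueness. *)
Lemma min_upto_xmin N : exists M, forall z, min_upto z M ->
  ipath_edge z N = ipath_edge (xmin hB) N.
Proof.
apply: contrapT => /forallNP h.
have {h}/choice[z zP] : forall M, exists z,
    min_upto z M /\ ipath_edge z N <> ipath_edge (xmin hB) N.
  by move=> M; have /existsNP[z /not_implyP zM] := h M; exists z.
have [p [_ pz]] := @ipath_compact B (z @ \oo) _ filterT.
have agree n : exists2 M, n < M & ipath_edge (z M) n = ipath_edge p n.
  have Fn : (z @ \oo) (z @` [set M | n < M]).
    by exists n.+1 => // M nM; exists M.
  have [_ [[M nM <-] e]] := pz _ _ Fn (ipath_edge_near p n).
  by exists M.
have pmin : min_path p.
  by move=> n; have [M nM <-] := agree n; have [/min_uptoP + _] := zP M; apply.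
have [M _ eM] := agree N; have [_ +] := zP M; rewrite eM; apply.
have [_ [q [_ qu]] _] := hB.
by rewrite -(qu _ pmin) -(qu _ (xminP hB)).
Qed.

(** At the maximal path, images of nearby points have long minimal prefixes and so are close to
    [xmin hB]. Elsewhere the carry stops at a finite level, and a prefix decides. *)
Lemma vershik_continuous : continuous V.
Proof.
apply: (@continuous_comp_initial _ _ _ set_val).
apply: prod_continuous => N; apply/discrete_continuousP => x.
suff : \forall y \near x, ipath_edge (V y) N = ipath_edge (V x) N by [].
have [xmax|nmax] := pselect (max_path x).
  have [M VM] := min_upto_xmin N.
  apply: filterS (ipath_prefix_near x M) => y yx.
  rewrite /V (vershik_max _ xmax) VM // vershik_upto.
  by rewrite (max_upto_eq yx) max_path_upto.
have [k nk] : exists k, ~~ max_edge (ipath_edge x k).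
  by apply: contrapT => /forallNP h; apply: nmax => n; apply/negPn/negP.
pose M := (maxn N k).+1.
apply: filterS (ipath_prefix_near x M) => y yx.
apply/esym/(@vershik_prefix _ _ M); last by rewrite ltnS leq_maxl.
  by move=> n nM; rewrite yx.
by apply: contra nk => /max_uptoP; apply; rewrite ltnS leq_maxr.
Qed.

Hypothesis foc : focused B.

(* [focused] is what makes edge [N] of [x] decide the range of edge [N] of
   [V x], hence the all-minimal path below it. *)
Lemma vershik_carry x y N :
  max_upto x N -> max_upto y N -> ipath_edge x N = ipath_edge y N ->
  forall n, n < N -> ipath_edge (V x) n = ipath_edge (V y) n.
Proof.
move=> xN yN e; apply: min_upto_inj; rewrite ?vershik_upto //.
have [exN|nxN] := boolP (max_edge (ipath_edge x N)); last first.
  congr rng; apply: (@succ_edge_uniq _ _ (ipath_edge x N)).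
    exact: vershik_succ.
  by rewrite e; apply: vershik_succ => //; rewrite -e.
have minV z : max_upto z N -> max_edge (ipath_edge z N) ->
    min_edge (ipath_edge (V z) N).
  move=> zN ezN; have : min_upto (V z) N.+1.
    by rewrite vershik_upto max_uptoS zN.
  by rewrite min_uptoS => /andP[].
by apply: foc; apply: minV => //; rewrite -e.
Qed.

End Vershik.

(** Reversal swaps minimal and maximal edges, so its adic map inverts that of [B]. It is transparent
    so that both orders have convertible path spaces. *)
Definition reverse : ordered_bratteli.
Proof.
exists B (fun n (x y : edg B n) => ele y x) => n a.
have [refl anti trans tot] := ele_linear a; split.
- exact: refl.
- by move=> x y xa ya; rewrite andbC; exact: anti.
- by move=> y x z ya xa za xy yz; exact: (trans y z x).
- by move=> x y xa ya; rewrite orbC; exact: tot.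
Defined.

End Adic.

(** * The inverse of the adic map, from the reversed order *)

Section Inverse.
Variable (B : ordered_bratteli).
Implicit Types x y z : ipath B.

Lemma succ_edge_reverse n (e f : edg B n) :
  @succ_edge (reverse B) n e f -> succ_edge f e.
Proof.
move=> [sf fe nef emax]; split=> //; first by rewrite eq_sym.
move=> g sg fg nfg; have [refl _ _ tot] := ele_linear (src e).
have /orP[//|ge] : ele e g || ele g e by apply: tot; rewrite inE ?sg ?sf.
have [->|neg] := eqVneq e g; first by apply: refl; rewrite inE sg sf.
have gf : ele g f by apply: emax; rewrite // sg sf.
by rewrite (ele_anti _ fg gf) ?eqxx ?sg // in nfg.
Qed.

Lemma adic_step_reverse x y : @adic_step (reverse B) x y -> adic_step y x.
Proof.
move=> [k [[xmin nxk] yx /succ_edge_reverse ysucc ymax]].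
exists k; split=> //; last by move=> n kn; rewrite yx.
by split=> //; exact: succ_edge_nmax ysucc.
Qed.

Lemma properly_ordered_reverse :
  properly_ordered B -> properly_ordered (reverse B).
Proof. by case=> ? ? ?; split. Qed.

End Inverse.

Section Inverse.
Variables (B : ordered_bratteli) (hB : properly_ordered B).
Let V := vershik hB.
Let W := vershik (properly_ordered_reverse hB).
Implicit Types x y z : ipath B.

Lemma vershik_reverseK : cancel W V.
Proof.
move=> x; apply: (@vershik_unique _ hB).
have := vershik_cases (properly_ordered_reverse hB) x.
by move=> [/adic_step_reverse|[? ?]]; [left|right].
Qed.

Lemma vershikK : cancel V W.
Proof.
move=> x; apply: (@vershik_unique _ (properly_ordered_reverse hB)).
have [h|[xmax Vmin]] := vershik_cases hB x; last by right.
by left; exact: (@adic_step_reverse (reverse B)).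
Qed.

End Inverse.

(** * The degenerate case of a path both minimal and maximal *)

Section SinglePath.
Variable B : ordered_bratteli.

Lemma fpath_rng_forced (v : forall n, vtx B n) :
  (forall n (e : edg B n), src e = v n.+1 -> rng e = v n) ->
  forall m d (p : projT1 (Defs.fpath B m d)), fpath_src p = v (d + m) ->
  fpath_rng p = v m.
Proof.
move=> vP m; elim=> [//|d IHd]; rewrite /fpath_src /fpath_rng /=.
move: IHd; rewrite /fpath_src /fpath_rng.
case: (Defs.fpath B m d) => T [s r] /= IHd.
by move=> [[e q] /= /eqP eq] /vP; rewrite eq => /IHd.
Qed.

(** Sources in a telescoping are cast along an equality of levels; this removes the cast. *)
Lemma ecast_vtx (v : forall n, vtx B n) i j (ij : i = j) (a : vtx B i) :
  ecast k (vtx B k) ij a = v j -> a = v i.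
Proof. by case: _ / ij. Qed.

(** Each edge of [p] is alone at its source, so finite paths starting on [p] stay on it. By
    simplicity they reach every vertex of level [n k]; hence [x] meets [p] at arbitrarily high
    levels and follows it down. *)
Lemma simple_min_max_unique (p x : ipath B) :
  simple B -> min_path p -> max_path p -> x = p.
Proof.
move=> [n [n0 [n_incr conn]]] pmin pmax.
have p_only k (e : edg B k) :
    src e = src (ipath_edge p k) -> e = ipath_edge p k.
  move=> se; apply: ele_anti => //.
    by have /forallP/(_ e) := pmax k; rewrite se eqxx.
  by have /forallP/(_ e) := pmin k; rewrite se eqxx.
have forced k (e : edg B k) :
    src e = rng (ipath_edge p k.+1) -> rng e = rng (ipath_edge p k).
  by rewrite -ipath_src => /p_only ->.
have all_through k (a : vtx B (n k)) : a = rng (ipath_edge p (n k)).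
  have [e [se <-]] := conn k (rng (ipath_edge p (n k.+1))) a.
  pose v i := rng (ipath_edge p i).
  exact: (@fpath_rng_forced v forced _ _ e (ecast_vtx (v := v) se)).
have n_ge k : k <= n k by elim: k => // k IHk; exact: leq_ltn_trans (n_incr k).
have down d k : rng (ipath_edge x (d + k)) = rng (ipath_edge p (d + k)) ->
    rng (ipath_edge x k) = rng (ipath_edge p k).
  elim: d => // d IHd e; apply: IHd.
  by rewrite (p_only _ (ipath_edge x (d + k))) // !ipath_src.
apply: ipath_ext => k; apply: p_only; rewrite !ipath_src.
apply: (down (n k.+1 - k.+1)); rewrite subnK //; exact: all_through.
Qed.

End SinglePath.

(** * The space-time coding *)

Section Coding.
Variables (B : ordered_bratteli) (hB : properly_ordered B) (foc : focused B).
Variables (K m : nat).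
Hypothesis width : forall n, #|edg B n| <= K.
Hypothesis nondeg : forall z : ipath B, min_upto z m -> ~~ max_upto z m.
Implicit Types x y z : ipath B.

Let V := vershik hB.
Let W := vershik (properly_ordered_reverse hB).
Let WK : cancel W V := vershik_reverseK hB.
Let VK : cancel V W := vershikK hB.

Let code n (e : edg B n) : 'I_K.+1 := inord (enum_rank e).

Let code_inj n : injective (@code n).
Proof.
move=> e f /(congr1 val); rewrite /= !inordK ?ltnS.
- by move/val_inj/enum_rank_inj.
- by rewrite (leq_trans (ltnW (ltn_ord _))).
- by rewrite (leq_trans (ltnW (ltn_ord _))).
Qed.

Let state := ({ffun 'I_m.+1 -> 'I_K.+1} * 'I_K.+1 * bool)%type.

(** Edges 0 to [m] are repeated in every cell: cell 0 updates them without help from the left, and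
    each later cell takes them over from its left neighbour. *)
Let s n z : state :=
  ([ffun i : 'I_m.+1 => code (ipath_edge z i)], code (ipath_edge z (m + n)),
   min_upto z (m + n).+1).

Let sE n z y : s n z = s n y ->
  [/\ forall i, i < m.+1 -> ipath_edge z i = ipath_edge y i,
      ipath_edge z (m + n) = ipath_edge y (m + n)
    & min_upto z (m + n).+1 = min_upto y (m + n).+1].
Proof.
move=> [/ffunP pre /code_inj e f]; split=> // i im.
by apply: code_inj; have := pre (Ordinal im); rewrite !ffunE.
Qed.

Let s_eq n z y :
  (forall i, i < m.+1 -> ipath_edge z i = ipath_edge y i) ->
  ipath_edge z (m + n) = ipath_edge y (m + n) ->
  min_upto z (m + n) = min_upto y (m + n) -> s n z = s n y.
Proof.
move=> pre e f; congr (_, _, _); last by rewrite !min_uptoS e f.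
  by apply/ffunP => i; rewrite !ffunE pre.
by rewrite e.
Qed.

(* The right neighbour shows [W z]; at a pending carry this is as good as [z]. *)
Lemma vershik_lag z y N : m <= N -> max_upto z N -> max_upto y N ->
  ipath_edge (W z) N = ipath_edge (W y) N -> ipath_edge z N = ipath_edge y N.
Proof.
have lag x : m <= N -> max_upto x N -> ipath_edge (W x) N = ipath_edge x N.
  move=> mN /max_uptoP xN; apply: (@vershik_above (reverse B) _ _ m) => //.
  apply/negP => /nondeg/negP; apply; apply/max_uptoP => n nm.
  by apply: xN; exact: leq_trans mN.
by move=> mN zN yN; rewrite !lag.
Qed.

(** The displayed prefix itself tells whether the carry passes edge [m]. If it does, edge [m.+1],
    shown with lag by cell 1, decides the new prefix. *)
Let s0_local z y : s 0 z = s 0 y -> s 1 (W z) = s 1 (W y) ->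
  s 0 (V z) = s 0 (V y).
Proof.
move=> /sE[pre _ _] /sE[_ + _]; rewrite addn1 => eW.
have preV i : i < m.+1 -> ipath_edge (V z) i = ipath_edge (V y) i.
  have zy := max_upto_eq pre.
  have [zmax|] := boolP (max_upto z m.+1); last first.
    by move=> nzmax; exact: (vershik_prefix hB pre).
  apply: (vershik_carry hB foc) => //; first by rewrite -zy.
  by apply: vershik_lag => //; rewrite -?zy.
apply: s_eq => //; first by rewrite addn0 preV.
by rewrite addn0; apply: min_upto_eq => i im; rewrite preV // ltnW.
Qed.

(** The left bit, taken after the step, says by [vershik_upto] whether the carry arrives. The edge
    then stays if there is no carry, moves to its successor if it is not maximal, and otherwise is
    decided by the right neighbour's edge. *)
Let sS_local n z y : s n (V z) = s n (V y) -> s n.+1 z = s n.+1 y ->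
  s n.+2 (W z) = s n.+2 (W y) -> s n.+1 (V z) = s n.+1 (V y).
Proof.
move=> /sE[pre _ f] /sE[_ e _] /sE[_ eW _].
rewrite !addnS in f e eW; apply: s_eq; rewrite ?addnS //.
have zy : max_upto z (m + n).+1 = max_upto y (m + n).+1.
  by rewrite -!vershik_upto.
have [zmax|nzmax] := boolP (max_upto z (m + n).+1); last first.
  by rewrite !(@vershik_above _ hB _ (m + n).+1) -?zy.
have ymax : max_upto y (m + n).+1 by rewrite -zy.
have [ezmax|nezmax] := boolP (max_edge (ipath_edge z (m + n).+1)); last first.
  apply: (@succ_edge_uniq _ _ (ipath_edge z (m + n).+1)).
    exact: vershik_succ.
  by rewrite e; apply: vershik_succ => //; rewrite -e.
have zmax' : max_upto z (m + n).+2 by rewrite max_uptoS zmax.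
have ymax' : max_upto y (m + n).+2 by rewrite max_uptoS ymax -e.
apply: (vershik_carry hB foc zmax' ymax') => //.
by apply: vershik_lag => //; rewrite -!addnS leq_addr.
Qed.

(** Negative cells hold a constant, so cell 0 learns nothing from its left. *)
Let t (k : int) x : state :=
  if k is Posz n then s n (iter n W x) else ([ffun=> ord0], ord0, false).

Let iterWV n x : iter n W (V x) = V (iter n W x).
Proof. by elim: n => //= n ->; rewrite VK WK. Qed.

Let iterWK n x : iter n W (iter n V x) = x.
Proof. by elim: n => //= n IHn; rewrite iterWV VK. Qed.

Let t_local k x y : t (k - 1)%R x = t (k - 1)%R y -> t k x = t k y ->
  t (k + 1)%R x = t (k + 1)%R y -> t k (V x) = t k (V y).
Proof.
have succZ n : (Posz n + 1)%R = Posz n.+1 by rewrite -PoszD addn1.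
have iterS n a : iter n.+1 W a = W (iter n W a) by [].
have predZ n : (Posz n.+1 - 1)%R = Posz n by rewrite -succZ addrK.
case: k => [[|n]|//]; rewrite succZ ?predZ /t.
  by move=> _; exact: s0_local.
rewrite !iterWV !iterS; move: (iter n W x) (iter n W y) => z w.
(* The middle cell displays [W z]; the left one displays [z], which is [V (W z)]. *)
by rewrite -[in X in X -> _](WK z) -[in X in X -> _](WK w); exact: sS_local.
Qed.

Let t_sep x y :
  (forall k j, t k (iter j V x) = t k (iter j V y)) -> x = y.
Proof.
move=> xy; apply: ipath_ext => n.
(* After [n] steps the lag of cell [n] is undone, and it displays [x] itself. *)
have /= := xy (Posz n) n; rewrite !iterWK => /sE[pre e _].
have [nm|mn] := ltnP n m.+1; first exact: pre.
have /= := xy (Posz (n - m)) (n - m); rewrite !iterWK => /sE[_ + _].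
by rewrite subnKC // ltnW.
Qed.

Let iterW_continuous n : continuous (iter n W).
Proof.
elim: n => [|n IHn] x; first exact: cvg_id.
by apply: continuous_comp; [exact: IHn | exact: vershik_continuous].
Qed.

Let t_near k x : \forall y \near x, t k y = t k x.
Proof.
case: k => n; last by apply: (@nearW _ _ _ (nbhs_filter x)).
have := @iterW_continuous n x _ (ipath_prefix_near (iter n W x) (m + n).+1).
apply: (@filterS _ _ (nbhs_filter x)) => y /= yx; apply: s_eq.
- by move=> i im; apply: yx; rewrite (leq_trans im) // ltnS leq_addr.
- exact: yx.
- by apply: min_upto_eq => i /leqW; exact: yx.
Qed.

Lemma vershik_embeds : exists (C : finType) (Phi : config C -> config C),
  cellular_automaton Phi /\ embeds Phi V.
Proof.
exact: (local_coding_embeds (@ipath_compact B) t_near t_sep t_local).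
Qed.

End Coding.

(** * The offset [m] of the coding, and the embedding *)

Theorem theorem1 (B : ordered_bratteli) (hB : properly_ordered B)
    (hfoc : focused B) (hwidth : bounded_width B) :
  exists (C : finType) (Phi : config C -> config C),
    cellular_automaton Phi /\ embeds Phi (vershik hB).
Proof.
pose p := xmin hB; pose q : ipath B := xmin (properly_ordered_reverse hB).
have pmin : min_path p := xminP hB.
have qmax : max_path q := xminP (properly_ordered_reverse hB).
have [pq|pq] := pselect (p = q).
  have single x : x = p.
    have [B_simple _ _] := hB.
    by apply: simple_min_max_unique => //; rewrite pq.
  (* A one-point system is coded by a single symbol. *)
  apply: (@local_coding_embeds _ _ unit (fun _ _ => tt)) => //.
    exact: ipath_compact.
    by move=> n x; apply: (@nearW _ _ _ (nbhs_filter x)).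
  by move=> x y _; rewrite (single x) (single y).
have [N pqN] : exists N, ipath_edge p N <> ipath_edge q N.
  by apply/existsNP => pqE; apply: pq; exact: ipath_ext.
have [M1 zp] := min_upto_xmin hB N.
have [M2 zq] := min_upto_xmin (properly_ordered_reverse hB) N.
have [K width] := hwidth.
(* A prefix of this length both minimal and maximal would force edge [N] to be that of [p] and that
   of [q], which differ. *)
apply: (@vershik_embeds B hB hfoc K (maxn M1 M2)) => [n|z /min_uptoP zmin].
  by case: (width n).
apply/negP => /max_uptoP zmax; apply: pqN; rewrite -(zp z); last first.
  by apply/min_uptoP => n nM; apply: zmin; rewrite leq_max nM.
have zmax2 : max_upto z M2.
  by apply/max_uptoP => n nM; apply: zmax; rewrite leq_max nM orbT.
exact: zq z zmax2.
Qed.
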